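(* Let $P$ be a uniplicit Markov kernel on a finite set $V$ and let $x_0,x_1\in\mathcal{H}(P)$. Then there exists $g\in\mathcal{S}_P$ such that $g(x_1)=x_0$. Conversely, any $g\in\mathcal{S}_P$ stabilizes $\mathcal{H}(P)$, so that $\mathcal{H}(P)$ is the orbit of any of its elements under $\mathcal{S}_P$.
   Context: A Markov kernel on a finite set $V$ is a $V\times V$ matrix with non-negative entries and row sums equal to 1. It is reversible if there is a probability measure $\mu$, positive at every point of $V$, with $\mu(x)P(x,y)=\mu(y)P(y,x)$ for all $x,y\in V$. It is uniplicit if it is reversible and all its eigenvalues have multiplicity 1. $\mathcal{K}(P)$ is the set of Markov kernels $K$ on $V$ with $KP=PK$; $\mathcal{K}(P,x)=\{K(x,\cdot):K\in\mathcal{K}(P)\}\subset\mathcal{P}(V)$, where $\mathcal{P}(V)$ is the set of probability measures on $V$; and $\mathcal{H}(P)=\{x\in V:\mathcal{K}(P,x)=\mathcal{P}(V)\}$. The symmetry group $\mathcal{S}_P$ is the set of bijections $g:V\to V$ with $P(g(x),g(y))=P(x,y)$ for all $x,y\in V$. *)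

(* Defs.v *)
From HB Require Import structures.
From mathcomp Require Import all_boot all_order all_algebra all_fingroup.
From mathcomp Require Import boolp classical_sets reals.

Set Implicit Arguments.
Unset Strict Implicit.
Unset Printing Implicit Defensive.

Import Order.TTheory GRing.Theory Num.Theory.
Local Open Scope ring_scope.
Local Open Scope classical_set_scope.

Section Markov.
Context {R : realType} {V : finType}.
Implicit Types (P K : V -> V -> R) (m : V -> R) (x y : V).

(* V x V matrices are functions V -> V -> R; [kmx] transports them to the
   library's matrices along the enumeration of V. *)
Definition kmx P : 'M[R]_#|V| := \matrix_(i, j) P (enum_val i) (enum_val j).

Definition probs : set (V -> R) :=
  [set m | (forall x, 0 <= m x) /\ \sum_x m x = 1].

Definition markov_kernel P : Prop :=
  (forall x y, 0 <= P x y) /\ (forall x, \sum_y P x y = 1).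

Definition reversible P : Prop :=
  exists m : V -> R, [/\ probs m, forall x, 0 < m x &
    forall x y, m x * P x y = m y * P y x].

(* The multiplicity is the algebraic one. A reversible kernel is diagonalizable
   over the reals, so it agrees with the geometric one, and restricting to real
   eigenvalues loses nothing. *)
Definition uniplicit P : Prop :=
  reversible P /\
  forall a : R, eigenvalue (kmx P) a -> mup a (char_poly (kmx P)) = 1%N.

Definition commuting_kernels P : set (V -> V -> R) :=
  [set K | markov_kernel K /\ kmx K *m kmx P = kmx P *m kmx K].

Definition commuting_rows P x : set (V -> R) :=
  [set K x | K in commuting_kernels P].

Definition hyper P : set V := [set x | commuting_rows P x = probs].

Definition symmetries P : {set {perm V}} :=
  [set g : {perm V} | [forall x, forall y, P (g x) (g y) == P x y]]%SET.

Lemma symmetriesP P (g : {perm V}) :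
  reflect (forall x y, P (g x) (g y) = P x y) (g \in symmetries P).
Proof.
rewrite inE; apply: (iffP forallP) => h x; last by apply/forallP => y; apply/eqP.
by move=> y; apply/eqP; move: y; apply/forallP.
Qed.

Lemma group_set_symmetries P : group_set (symmetries P).
Proof.
apply/group_setP; split; first by apply/symmetriesP => x y; rewrite !perm1.
move=> g h /symmetriesP gP /symmetriesP hP; apply/symmetriesP => x y.
by rewrite !permM hP gP.
Qed.

Canonical symmetries_group P := Group (group_set_symmetries P).

End Markov.

(* Main.v *)
(** Detailed balance makes P self-adjoint for a weighted inner product, so P is
    diagonalizable with real eigenvalues; these being simple, any two matrices
    commuting with P commute with each other. Hence, if x is in H(P), a matrix
    K commuting with P is determined by its row at x: taking M in K(P) with
    M(x, .) = delta_y, the row K(y, .) = (M K)(x, .) = (K M)(x, .) depends only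
    on K(x, .). For x0, x1 in H(P), choose K, L in K(P) with
    K(x1, .) = delta_x0 and L(x0, .) = delta_x1. The row of K L at x1 is
    delta_x1, so K L = L K = 1, and a Markov kernel with a Markov inverse is a
    permutation, which here commutes with P and maps x1 to x0. *)

Require Import Defs.
From HB Require Import structures.
From mathcomp Require Import all_boot all_order all_algebra all_fingroup.
From mathcomp Require Import boolp classical_sets reals.
From mathcomp Require Import complex.

Set Implicit Arguments.
Unset Strict Implicit.
Unset Printing Implicit Defensive.

Import Order.TTheory GRing.Theory Num.Theory.
Local Open Scope ring_scope.
Local Open Scope classical_set_scope.

(** * Commutants of matrices with simple spectrum *)

Lemma comm_diag_mx_inj (F : fieldType) n (d : 'rV[F]_n) (A : 'M[F]_n) :
  injective (d 0) -> A *m diag_mx d = diag_mx d *m A -> is_diag_mx A.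
Proof.
move=> d_inj /matrixP Ad; apply/is_diag_mxP => i j ne_ij.
have := Ad i j; rewrite mul_mx_diag mul_diag_mx !mxE mulrC => /eqP.
rewrite -subr_eq0 -mulrBl mulf_eq0 subr_eq0 => /orP[/eqP/d_inj eq_ji|/eqP//].
by rewrite eq_ji eqxx in ne_ij.
Qed.

(** In the eigenbasis of [A] given by [U], both [B] and [C] are diagonal because the entries of [d]
    are distinct, and diagonal matrices commute. *)
Lemma simple_spectrum_comm (F : fieldType) n (U A B C : 'M[F]_n) (d : 'rV[F]_n) :
  U \in unitmx -> conjmx U A = diag_mx d -> injective (d 0) ->
  B *m A = A *m B -> C *m A = A *m C -> B *m C = C *m B.
Proof.
move=> Uu UA d_inj BA CA.
have conjM X Y : conjmx U (X *m Y) = conjmx U X *m conjmx U Y.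
  by rewrite conjmxM// inE stablemx_unit.
have diagP X : X *m A = A *m X -> exists e, conjmx U X = diag_mx e.
  move=> XA; suff /diag_mxP[e ->] : is_diag_mx (conjmx U X) by exists e.
  by apply: (comm_diag_mx_inj d_inj); rewrite -UA -!conjM XA.
have [[b Ub] [c Uc]] := (diagP B BA, diagP C CA).
rewrite -[LHS](conjmxK _ Uu) -[RHS](conjmxK _ Uu) !conjM Ub Uc.
by rewrite diag_mxC.
Qed.

Lemma char_poly_conj (F : fieldType) n (U A : 'M[F]_n) :
  U \in unitmx -> char_poly (conjmx U A) = char_poly A.
Proof.
move=> Uu; rewrite /char_poly conjumx//.
pose pU := map_mx polyC U; pose pV := map_mx polyC (invmx U).
have UV : pU *m pV = 1%:M by rewrite -map_mxM mulmxV// map_mx1.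
have -> : char_poly_mx (U *m A *m invmx U) = pU *m char_poly_mx A *m pV.
  rewrite /char_poly_mx mulmxBr mulmxBl !map_mxM scalar_mxC.
  by rewrite -[X in _ = X - _]mulmxA UV mulmx1.
by rewrite !det_mulmx mulrAC -det_mulmx UV det1 mul1r.
Qed.

(** [U] is complex because it comes from the spectral theorem for normal matrices over [R[i]]; [d]
    is real because the symmetrized matrix is hermitian. *)
Lemma detailed_balance_diagonalizable (R : rcfType) n (A : 'M[R]_n)
    (w : 'I_n -> R) :
  (forall i, 0 < w i) -> (forall i j, w i * A i j = w j * A j i) ->
  exists (U : 'M[R[i]]_n) (d : 'rV[R]_n), U \in unitmx /\
    conjmx U (map_mx (real_complex R) A) = diag_mx (map_mx (real_complex R) d).
Proof.
move=> w_gt0 wA.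
pose rC := real_complex R.
pose s i := Num.sqrt (w i).
have s_neq0 i : s i != 0 by rewrite sqrtr_eq0 -ltNge.
have s2 i : s i * s i = w i by rewrite -expr2 sqr_sqrtr// ltW.
pose D : 'M[R[i]]_n := diag_mx (\row_i rC (s i)).
have Du : D \in unitmx.
  rewrite unitmxE det_diag unitfE; apply/prodf_neq0 => i _.
  by rewrite mxE fmorph_eq0.
(* Conjugating by the square roots of the weights makes [A] symmetric. *)
pose S : 'M[R[i]]_n := \matrix_(i, j) rC (s i * A i j / s j).
have DS : D *m map_mx rC A = S *m D.
  apply/matrixP => i j; rewrite mul_mx_diag mul_diag_mx !mxE -!rmorphM.
  by rewrite divfK.
have S_herm : S \is hermsymmx.
  apply: realsym_hermsym.
    apply/is_hermitianmxP; rewrite expr0 scale1r map_mx_id//.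
    apply/matrixP => i j; rewrite !mxE; congr rC.
    (* Clearing the denominators leaves the detailed balance [wA]. *)
    apply: (mulIf (s_neq0 i)); apply: (mulIf (s_neq0 j)).
    rewrite mulrAC !divfK//.
    by rewrite mulrAC s2 [RHS]mulrAC s2.
  by apply/mxOverP => i j; rewrite mxE complex_real.
have /orthomx_spectralP S_eq := hermitian_normalmx S_herm.
have Uu := spectral_unit S.
have d_real := mxOverP (hermitian_spectral_diag_real S_herm).
(* [S] is [A] conjugated by [D], so composing with [D] carries the eigenbasis of [S] back to [A]. *)
exists (spectralmx S *m D), (map_mx (@complex.Re R) (spectral_diag S)).
rewrite unitmx_mul Uu Du; split=> //.
have -> : map_mx rC (map_mx (@complex.Re R) (spectral_diag S)) = spectral_diag S.
  by apply/rowP => i; rewrite !mxE; exact: RRe_real.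
rewrite conjuMumx// [conjmx D _]conjumx// DS mulmxK//.
by rewrite {2}S_eq conjumx// mulmxA !mulmxA mulmxV// mul1mx mulmxK.
Qed.

Lemma detailed_balance_simple_comm (R : rcfType) n (A B C : 'M[R]_n)
    (w : 'I_n -> R) :
  (forall i, 0 < w i) -> (forall i j, w i * A i j = w j * A j i) ->
  (forall a, eigenvalue A a -> mup a (char_poly A) = 1%N) ->
  B *m A = A *m B -> C *m A = A *m C -> B *m C = C *m B.
Proof.
move=> w_gt0 wA simpleA BA CA.
have [U [d [Uu UA]]] := detailed_balance_diagonalizable w_gt0 wA.
have charA : char_poly A = \prod_(a <- [seq d 0 i | i <- enum 'I_n]) ('X - a%:P).
  (* The identity is checked over [R[i]], where [A] is similar to the diagonal matrix of [d]. *)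
  apply: (@map_poly_inj _ _ (real_complex R)).
  rewrite map_char_poly -(char_poly_conj _ Uu) UA.
  rewrite char_poly_trig ?diag_mx_is_trig// rmorph_prod big_map big_enum /=.
  apply: eq_bigr => i _.
  by rewrite rmorphB/= map_polyX map_polyC !mxE eqxx.
(* The number of occurrences of [a] in [d] is its multiplicity as a root of [char_poly A], hence
   1. *)
have d_inj : injective (d 0).
  apply/injectiveP; rewrite /injectiveb; apply: count_mem_uniq => a.
  have [a_d|/count_memPn//] := boolP (a \in _).
  rewrite -mu_prod_XsubC -charA simpleA//.
  by rewrite eigenvalue_root_char charA root_prod_XsubC.
apply: (map_mx_inj (f := real_complex R)); rewrite !map_mxM.
apply: (simple_spectrum_comm Uu UA).
- by move=> i j; rewrite !mxE => /complexI/d_inj.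
- by rewrite -!map_mxM BA.
- by rewrite -!map_mxM CA.
Qed.

(** * Kernels commuting with [P] *)

Section CommutingKernels.
Context {R : realType} {V : finType}.
Implicit Types (P K L : V -> V -> R) (m : V -> R) (x y z : V).

(** With both arguments free this is the identity matrix, so [kcomp K L = dirac] makes [L] an
    inverse of [K]. *)
Definition dirac x : V -> R := fun y => (x == y)%:R.

Definition kcomp K L : V -> V -> R := fun x y => \sum_z K x z * L z y.

Lemma sum_dirac_l x (f : V -> R) : \sum_z dirac x z * f z = f x.
Proof.
rewrite (bigD1 x)//= big1 ?addr0 /dirac ?eqxx ?mul1r// => z /negPf ne_zx.
by rewrite eq_sym ne_zx mul0r.
Qed.

Lemma sum_dirac_r x (f : V -> R) : \sum_z f z * dirac z x = f x.
Proof.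
rewrite -[RHS]sum_dirac_l; apply: eq_bigr => z _.
by rewrite mulrC /dirac eq_sym.
Qed.

Lemma probs_dirac x : probs (dirac x).
Proof.
split=> [y|]; first by rewrite /dirac ler0n.
by under eq_bigr do rewrite -[dirac _ _]mulr1; rewrite sum_dirac_l.
Qed.

Lemma kmx_comp K L : kmx K *m kmx L = kmx (kcomp K L).
Proof.
apply/matrixP => i j; rewrite !mxE /kcomp [RHS]big_enum_val /=.
by apply: eq_bigr => k _; rewrite !mxE.
Qed.

Lemma kmx_inj : injective (@kmx R V).
Proof.
move=> K L /matrixP KL; apply/funext => x; apply/funext => y.
by have := KL (enum_rank x) (enum_rank y); rewrite !mxE !enum_rankK.
Qed.

Lemma commuting_kernelsP P K :
  commuting_kernels P K <-> markov_kernel K /\ kcomp K P = kcomp P K.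
Proof.
by rewrite /commuting_kernels /= !kmx_comp; split=> -[? KP]; split=> //;
  [exact: kmx_inj | rewrite KP].
Qed.

Lemma kcompA : associative kcomp.
Proof. by move=> K L M; apply: kmx_inj; rewrite -!kmx_comp mulmxA. Qed.

Lemma uniplicit_kcompC P K L : uniplicit P ->
  kcomp K P = kcomp P K -> kcomp L P = kcomp P L -> kcomp K L = kcomp L K.
Proof.
move=> [[m [_ m_gt0 mP]] simpleP] KP LP; apply: kmx_inj; rewrite -!kmx_comp.
apply: (@detailed_balance_simple_comm _ _ (kmx P) _ _ (m \o enum_val)) => //=.
- by move=> i j; rewrite !mxE mP.
- by rewrite !kmx_comp KP.
- by rewrite !kmx_comp LP.
Qed.

Lemma hyperP P x : hyper P x <-> probs `<=` commuting_rows P x.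
Proof.
split=> [-> //|sub]; apply/seteqP; split=> // _ [K [[K_ge0 K1] _] <-].
by split=> //; exact: K1.
Qed.

Lemma hyper_eq_row P K L x : uniplicit P -> hyper P x ->
  kcomp K P = kcomp P K -> kcomp L P = kcomp P L -> K x = L x -> K = L.
Proof.
move=> uP /hyperP hx KP LP eqx; apply/funext => y; apply/funext => z.
have [M /commuting_kernelsP[_ MP] Mx] := hx _ (probs_dirac y).
have rowy N : kcomp N P = kcomp P N -> N y z = kcomp N M x z.
  move=> NP; rewrite (uniplicit_kcompC uP NP MP) /kcomp Mx.
  by rewrite sum_dirac_l.
by rewrite (rowy K)// (rowy L)// /kcomp eqx.
Qed.

(** If [K x y] is nonzero, [K L = 1] forces row [y] of [L] to be the Dirac mass at [x]; row [y] of
    [L K = 1] then reads [K x = dirac y]. *)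
Lemma inverse_kernels_perm K L : markov_kernel K -> markov_kernel L ->
  kcomp K L = dirac -> kcomp L K = dirac ->
  exists g : {perm V}, K = fun x => dirac (g x).
Proof.
move=> [K_ge0 K1] [L_ge0 L1] KL LK.
have rowK x : exists y, K x = dirac y /\ L y = dirac x.
  have [y Kxy] : exists y, K x y != 0.
    apply/existsP; apply: contraT => /existsPn K0.
    have := K1 x; rewrite big1 => [/esym/eqP|y _]; first by rewrite oner_eq0.
    by apply/eqP; rewrite -[_ == _]negbK K0.
  (* No cancellation in (K L)(x, z) = 0, so [L y] is concentrated at [x]. *)
  have Ly0 z : x != z -> L y z = 0.
    move=> /negPf ne_xz; have /eqP := congr1 (fun M => M x z) KL.
    rewrite /kcomp [dirac _ _]/dirac ne_xz psumr_eq0 => [/allP/(_ y)|w _].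
      by rewrite mem_index_enum mulf_eq0 (negPf Kxy) => /(_ isT)/eqP.
    by rewrite mulr_ge0.
  have Ly : L y = dirac x.
    apply/funext => z; rewrite /dirac; case: eqVneq => [<-|/Ly0//].
    by rewrite -(L1 y) (bigD1 x)//= big1 ?addr0// => w; rewrite eq_sym => /Ly0.
  exists y; split=> //; apply/funext => z.
  by rewrite -[RHS](congr1 (fun M => M y z) LK) /kcomp Ly sum_dirac_l.
have [g gP] := choice rowK.
have g_inj : injective g.
  move=> x y eq_g; have := (gP x).2; rewrite eq_g (gP y).2.
  move=> /(congr1 (fun f => f x)); rewrite /dirac eqxx.
  by case: eqVneq => // _ /eqP; rewrite eq_sym oner_eq0.
by exists (perm g_inj); apply/funext => x; rewrite permE (gP x).1.
Qed.

(** * The action of the symmetries on [hyper P] *)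

Lemma hyper_transitive P x0 x1 : uniplicit P -> hyper P x0 -> hyper P x1 ->
  exists2 g : {perm V}, g \in symmetries P & g x1 = x0.
Proof.
move=> uP h0 h1.
have /hyperP/(_ _ (probs_dirac x0))[K /commuting_kernelsP[K_markov KP] Kx1] := h1.
have /hyperP/(_ _ (probs_dirac x1))[L /commuting_kernelsP[L_markov LP] Lx0] := h0.
have diracP : kcomp dirac P = kcomp P dirac.
  apply/funext => x; apply/funext => y.
  by rewrite /kcomp sum_dirac_l sum_dirac_r.
have KL : kcomp K L = dirac.
  apply: (hyper_eq_row uP h1) => //.
    by rewrite -kcompA LP kcompA KP kcompA.
  by apply/funext => y; rewrite /kcomp Kx1 sum_dirac_l Lx0.
have LK : kcomp L K = dirac by rewrite -(uniplicit_kcompC uP KP LP).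
have [g Kg] := inverse_kernels_perm K_markov L_markov KL LK.
exists g; last first.
  have := congr1 (fun f => f x0) Kx1; rewrite Kg /dirac eqxx.
  by case: eqVneq => // _ /eqP; rewrite eq_sym oner_eq0.
apply/symmetriesP => x y.
(* At the entry [(x, g y)], [K P] equals [P (g x) (g y)] and [P K] equals [P x y]. *)
have := congr1 (fun M => M x (g y)) KP; rewrite Kg /kcomp sum_dirac_l => ->.
rewrite -[RHS]sum_dirac_r; apply: eq_bigr => z _.
by rewrite /dirac (inj_eq perm_inj).
Qed.

(** Conjugation by [g] preserves the kernels commuting with [P]; the row [m] at [g x] is obtained by
    conjugating a kernel whose row at [x] is [m \o g]. *)
Lemma hyper_symmetry P (g : {perm V}) x :
  g \in symmetries P -> hyper P x -> hyper P (g x).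
Proof.
move=> /symmetriesP gP /hyperP hx; apply/hyperP => m [m_ge0 m1].
have sum_perm (h : {perm V}) (f : V -> R) : \sum_y f (h y) = \sum_y f y.
  by rewrite [RHS](reindex_inj (@perm_inj _ h)).
have [|K /commuting_kernelsP[[K_ge0 K1] KP] Kx] := hx (m \o g).
  by split=> [y|]; [exact: m_ge0 | rewrite sum_perm].
exists (fun y z => K (g^-1 y)%g (g^-1 z)%g); last first.
  by apply/funext => y; rewrite permK Kx /= permKV.
apply/commuting_kernelsP; split.
  by split=> y *; [exact: K_ge0 | rewrite (sum_perm _ (K _)) K1].
have PV a b : P a b = P (g^-1 a)%g (g^-1 b)%g by rewrite -[RHS]gP !permKV.
apply/funext => y; apply/funext => z; rewrite /kcomp.
(* Both sums become those of [KP] at the points moved by [g^-1], reindexed along [g^-1]. *)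
under eq_bigr do rewrite PV; under [RHS]eq_bigr do rewrite PV.
have := congr1 (fun M => M (g^-1 y)%g (g^-1 z)%g) KP; rewrite /kcomp.
by rewrite -(sum_perm g^-1%g) -[in RHS](sum_perm g^-1%g).
Qed.

End CommutingKernels.

Theorem proposition5 (R : realType) (V : finType) (P : V -> V -> R)
    (P_markov : markov_kernel P) (P_uniplicit : uniplicit P) :
  [/\ forall x0 x1 : V, hyper P x0 -> hyper P x1 ->
        exists2 g : {perm V}, g \in symmetries P & g x1 = x0,
      forall g : {perm V}, g \in symmetries P -> [set g x | x in hyper P] = hyper P
    & forall x : V, hyper P x -> hyper P = [set` orbit 'P (symmetries_group P) x]].
Proof.
split=> [x0 x1 h0 h1|g gP|x hx].
- exact: hyper_transitive.
- apply/seteqP; split=> [_ [x hx <-]|x hx]; first exact: hyper_symmetry.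
  have gVP : (g^-1)%g \in symmetries P by rewrite groupV.
  by exists ((g^-1)%g x); [exact: hyper_symmetry | rewrite permKV].
- apply/seteqP; split=> [y hy|y /orbitP[g gP <-]]; last exact: hyper_symmetry.
  have [g gP <-] := hyper_transitive P_uniplicit hy hx.
  by apply/orbitP; exists g.
Qed.
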